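(* Let $f\colon\mathbb{H}\to\mathbb{H}$ be a hyperbolic map with Denjoy--Wolff point $\infty$. For any $w\in\mathbb{H}$, consider the hyperbolic geodesic $\gamma$ of $\mathbb{H}$ emanating from $w$ and landing at $\infty$. If $z\in\mathbb{H}$ and $\{\pi_\gamma(f^n(z))\}$ denotes the sequence of projections of $f^n(z)$ onto $\gamma$, then the sequence $\{d_{\mathbb{H}}(w,\pi_\gamma(f^n(z)))\}$ is eventually strictly increasing.
   Context: $\mathbb{H}=\{w\in\mathbb{C}:\mathrm{Re}\,w>0\}$ is the right half-plane, with hyperbolic metric $$d_{\mathbb{H}}(z,w)=\frac12\log\frac{1+\left|\frac{z-w}{z+\overline{w}}\right|}{1-\left|\frac{z-w}{z+\overline{w}}\right|},\qquad z,w\in\mathbb{H}.$$ The hyperbolic geodesics of $\mathbb{H}$ are the (arcs of) Euclidean half-lines and semicircles in $\mathbb{H}$ perpendicular to the imaginary axis; the geodesic emanating from $w$ and landing at $\infty$ is the horizontal half-line $\gamma(t)=w+t$, $t\ge0$. The projection $\pi_\gamma(z_0)$ of $z_0\in\mathbb{H}$ onto $\gamma$ is the (for a geodesic, unique) point $\gamma(t_0)$, $t_0\geq 0$, with $d_{\mathbb{H}}(z_0,\gamma(t_0))=\inf_{t\ge0}d_{\mathbb{H}}(z_0,\gamma(t))$. $f^n$ denotes the $n$-th iterate of $f$. A holomorphic $f\colon\mathbb{H}\to\mathbb{H}$ has Denjoy--Wolff point $\infty$ if it has no fixed points in $\mathbb{H}$ and $f^n\to\infty$ uniformly on compact subsets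 of $\mathbb{H}$. In that case the angular derivative $f'(\infty)=\angle\lim_{z\to\infty}\frac{f(z)}{z}$ exists and lies in $[1,+\infty)$, where the angular limit means that $z\to\infty$ within any sector $\{|\arg z|<\phi\}$, $\phi\in(0,\tfrac{\pi}{2})$. The map $f$ is hyperbolic if $f'(\infty)>1$. A sequence is eventually strictly increasing if there is an index from which on it is strictly increasing. *)

(* Defs.v *)
From Stdlib Require Import Reals List ClassicalEpsilon.
From Coquelicot Require Import Coquelicot.
Open Scope R_scope.

(* A self-map of [RHP] is a total function on [C] preserving [RHP]; its values
   outside [RHP] are irrelevant. *)
Definition RHP (z : C) : Prop := 0 < Re z.

Definition dH (z w : C) : R :=
  let rho := Cmod ((z - w) / (z + Cconj w))%C in
  1 / 2 * ln ((1 + rho) / (1 - rho)).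

(* As [RHP] is open, complex differentiability at a point of [RHP] only depends
   on the restriction of [f] to [RHP]. *)
Definition holomorphic_self_map (f : C -> C) : Prop :=
  (forall z : C, RHP z -> RHP (f z)) /\
  (forall z : C, RHP z -> @ex_derive C_AbsRing C_NormedModule f z).

Definition iterate (f : C -> C) (n : nat) (z : C) : C := Nat.iter n f z.

Definition compact_set (K : C -> Prop) : Prop :=
  forall (I : Type) (U : I -> C -> Prop),
    (forall i : I, @open C_UniformSpace (U i)) ->
    (forall z : C, K z -> exists i : I, U i z) ->
    exists l : list I, forall z : C, K z -> exists i : I, In i l /\ U i z.

Definition Denjoy_Wolff_infty (f : C -> C) : Prop :=
  (forall z : C, RHP z -> f z <> z) /\
  (forall K : C -> Prop, compact_set K -> (forall z : C, K z -> RHP z) ->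
    forall M : R,
      eventually (fun n : nat => forall z : C, K z -> M < Cmod (iterate f n z))).

(* [|arg z| < phi], with the argument expressed by polar coordinates. *)
Definition sector (phi : R) (z : C) : Prop :=
  exists r theta : R,
    0 < r /\ Rabs theta < phi /\ z = (r * cos theta, r * sin theta).

(* Neighbourhoods of the point at infinity of the Riemann sphere. *)
Definition C_infty (P : C -> Prop) : Prop :=
  exists M : R, forall z : C, M < Cmod z -> P z.

Definition angular_limit_infty (g : C -> C) (l : C) : Prop :=
  forall phi : R, 0 < phi < PI / 2 ->
    filterlim g (within (sector phi) C_infty) (@locally C_UniformSpace l).

Definition is_angular_derivative_infty (f : C -> C) (l : R) : Prop :=
  angular_limit_infty (fun z : C => (f z / z)%C) (RtoC l).

Definition hyperbolic_infty (f : C -> C) : Prop :=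
  Denjoy_Wolff_infty f /\
  exists l : R, is_angular_derivative_infty f l /\ 1 < l.

(* The geodesic ray emanating from [w] and landing at infinity, for [0 <= t]. *)
Definition geodesic_to_infty (w : C) (t : R) : C := (w + RtoC t)%C.

Definition is_projection (gamma : R -> C) (z0 p : C) : Prop :=
  exists t0 : R, 0 <= t0 /\ p = gamma t0 /\
    Finite (dH z0 (gamma t0)) =
    Glb_Rbar (fun d : R => exists t : R, 0 <= t /\ d = dH z0 (gamma t)).

(* Meaningful because a projection onto a geodesic exists and is unique. *)
Definition projection (gamma : R -> C) (z0 : C) : C :=
  epsilon (inhabits (RtoC 0)) (is_projection gamma z0).

Definition eventually_strictly_increasing (u : nat -> R) : Prop :=
  exists N : nat, forall n m : nat, (N <= n)%nat -> (n < m)%nat -> u n < u m.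

(* Main.v *)
Require Import Defs.
From Stdlib Require Import Reals Lra Lia Classical ClassicalEpsilon.
From Coquelicot Require Import Coquelicot.

(** The projection of [z0] onto the horizontal geodesic line through [w = a + i b]
    is the point [i b + |z0 - i b|], because the geodesics orthogonal to that line
    are the semicircles centred at [i b].  It lies on the ray from [w] once
    [|z0 - i b| > a] ([projection_ray]), and along the ray the hyperbolic distance
    to [w] increases ([dH_along_ray]).  It thus suffices that the Euclidean
    distances [|f^n z - i b|] eventually exceed [a] and strictly increase.

    Write [l > 1] for the angular derivative and [x_n + i y_n] for the orbit.
    Julia's lemma ([julia]) gives [x_(n+1) >= l * x_n], so the orbit tends to
    infinity.  A self-map contracts hyperbolic distances, so consecutive points
    of the orbit stay at bounded hyperbolic distance, whence
    [|y_(n+1) - y_n| <= K * x_n] ([im_variation_bound]).  The two facts together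
    bound [|y_n| / x_n] ([orbit_slope]): the orbit stays in a sector, the angular
    limit applies along it, and [|f^(n+1) z| / |f^n z|] tends to [l > 1]
    ([orbit_dist_increasing]).

    Both ingredients follow from the infinitesimal Schwarz--Pick inequality
    [|f'(z)| <= Re (f z) / Re z] ([schwarz_pick_derivative]).  After composition
    with affine maps one may assume [f 1 = 1], and the claim is [|f'(1)| <= 1].
    It suffices to bound [|f'(1)|] by any constant valid for all self-maps fixing
    [1], since the iterates of [f] have derivatives [f'(1)^n].  Such a bound is an
    estimate of Borel--Caratheodory type on a disc: in logarithmic coordinates it
    compares the means over two circles of a function with a suitable kernel, and
    these means agree by Goursat's theorem on rectangles ([goursat]), proved by
    bisection because the derivative is not known to be continuous. *)

(** * Goursat's theorem on rectangles *)

Lemma half_pow_lim (h : R) : is_lim_seq (fun n => h * (1 / 2) ^ n) 0.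
Proof.
replace (Finite 0) with (Rbar_mult h 0).
2: { simpl; f_equal; ring. }
apply is_lim_seq_scal_l, is_lim_seq_geom.
rewrite Rabs_pos_eq; lra.
Qed.

Lemma nested_point (u v : nat -> R) (h : R) :
  (forall n, u n <= u (S n)) -> (forall n, v (S n) <= v n) ->
  (forall n, v n - u n = h * (1 / 2) ^ n) ->
  exists x, forall n, u n <= x <= v n.
Proof.
intros Hu Hv Hd.
assert (Hl : is_lim_seq (fun n => v n - u n) 0).
{ apply is_lim_seq_ext with (2 := half_pow_lim h). now intros n. }
destruct (ex_lim_seq_adj u v Hu Hv Hl) as [Eu [Ev E]].
apply Lim_seq_correct' in Eu. apply Lim_seq_correct' in Ev.
exists (real (Lim_seq u)). intros n. split.
- now apply is_lim_seq_incr_compare.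
- rewrite E. now apply is_lim_seq_decr_compare.
Qed.

(** If the conclusion failed on the whole rectangle it would fail on one of its
    four quarters, and so on; the nested bad rectangles close in on a point,
    where the local hypothesis is violated.  The local hypothesis only concerns
    rectangles that contain the point: this is what a derivative controls. *)
Lemma bisection_2d (Good : R -> R -> R -> R -> Prop) (a b c d : R) :
  a <= b -> c <= d ->
  (forall a' b' c' d', a <= a' -> a' <= b' -> b' <= b ->
     c <= c' -> c' <= d' -> d' <= d ->
     let m := (a' + b') / 2 in let n := (c' + d') / 2 in
     Good a' m c' n -> Good m b' c' n -> Good a' m n d' -> Good m b' n d' ->
     Good a' b' c' d') ->
  (forall x y, a <= x <= b -> c <= y <= d ->
     exists delta, 0 < delta /\ forall a' b' c' d',
       a <= a' -> a' <= x <= b' -> b' <= b ->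
       c <= c' -> c' <= y <= d' -> d' <= d ->
       b' - a' < delta -> d' - c' < delta -> Good a' b' c' d') ->
  Good a b c d.
Proof.
intros Hab Hcd Hstep Hloc.
apply NNPP; intros Hbad.
pose (T := (R * R * R * R)%type).
pose (ok := fun r : T => let '(a', b', c', d') := r in
   a <= a' <= b' /\ b' <= b /\ c <= c' <= d' /\ d' <= d /\ ~ Good a' b' c' d').
assert (Hnext : forall r : T, exists r' : T, ok r ->
   ok r' /\
   let '(a1, b1, c1, d1) := r in let '(a2, b2, c2, d2) := r' in
   a1 <= a2 /\ b2 <= b1 /\ c1 <= c2 /\ d2 <= d1 /\
   b2 - a2 = (b1 - a1) / 2 /\ d2 - c2 = (d1 - c1) / 2).
{ intros [[[a1 b1] c1] d1].
  destruct (classic (ok (a1, b1, c1, d1))) as [H|H].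
  2: { exists (0, 0, 0, 0). tauto. }
  pose proof H as (H1 & H2 & H3 & H4 & H5).
  set (m := (a1 + b1) / 2). set (n := (c1 + d1) / 2).
  assert (Q : exists a2 b2 c2 d2,
      ((a2 = a1 /\ b2 = m) \/ (a2 = m /\ b2 = b1)) /\
      ((c2 = c1 /\ d2 = n) \/ (c2 = n /\ d2 = d1)) /\ ~ Good a2 b2 c2 d2).
  { apply NNPP; intros Hn. apply H5. apply Hstep; try lra;
    apply NNPP; intros Hg; apply Hn; fold m n in Hg;
    do 4 eexists; (split; [ | split; [ | exact Hg]]); tauto. }
  assert (m = (a1 + b1) / 2) by reflexivity.
  assert (n = (c1 + d1) / 2) by reflexivity.
  destruct Q as (a2 & b2 & c2 & d2 & Qx & Qy & Q).
  exists (a2, b2, c2, d2); intros _; clearbody m n; clear Hstep Hloc;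
  destruct Qx as [[-> ->]|[-> ->]]; destruct Qy as [[-> ->]|[-> ->]];
  (split; [split; [|split; [|split; [|split; [|exact Q]]]]|]); lra. }
pose (next := fun r => proj1_sig (constructive_indefinite_description _ (Hnext r))).
pose (rs := fun n => Nat.iter n next (a, b, c, d)).
assert (Hok : forall n, ok (rs n)).
{ induction n as [|n IH].
  - simpl. repeat split; try lra. exact Hbad.
  - simpl. unfold next at 1.
    destruct (constructive_indefinite_description _ (Hnext (rs n))) as [r' Hr'].
    simpl. now apply Hr'. }
pose (A := fun n => let '(a', _, _, _) := rs n in a').
pose (B := fun n => let '(_, b', _, _) := rs n in b').
pose (C := fun n => let '(_, _, c', _) := rs n in c').
pose (D := fun n => let '(_, _, _, d') := rs n in d').
assert (Hrs : forall n, a <= A n <= B n /\ B n <= b /\ c <= C n <= D n /\ D n <= d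
   /\ ~ Good (A n) (B n) (C n) (D n)).
{ intros n. generalize (Hok n). unfold A, B, C, D, ok.
  now destruct (rs n) as [[[? ?] ?] ?]. }
assert (HS : forall n, A n <= A (S n) /\ B (S n) <= B n /\ C n <= C (S n) /\
   D (S n) <= D n /\ B (S n) - A (S n) = (B n - A n) / 2 /\
   D (S n) - C (S n) = (D n - C n) / 2).
{ intros n. generalize (Hok n). unfold A, B, C, D.
  change (rs (S n)) with (next (rs n)). unfold next.
  destruct (constructive_indefinite_description _ (Hnext (rs n))) as [r' Hr'].
  simpl. intros H. destruct (Hr' H) as [_ K]. revert K.
  destruct (rs n) as [[[? ?] ?] ?]; destruct r' as [[[? ?] ?] ?]. tauto. }
assert (HBA : forall n, B n - A n = (b - a) * (1 / 2) ^ n).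
{ induction n as [|n IH]; [unfold A, B; simpl; lra|].
  destruct (HS n) as (_ & _ & _ & _ & H & _). rewrite H, IH. simpl. field. }
assert (HDC : forall n, D n - C n = (d - c) * (1 / 2) ^ n).
{ induction n as [|n IH]; [unfold C, D; simpl; lra|].
  destruct (HS n) as (_ & _ & _ & _ & _ & H). rewrite H, IH. simpl. field. }
destruct (nested_point A B (b - a)) as [x Hx]; try (intros n; apply HS); auto.
destruct (nested_point C D (d - c)) as [y Hy]; try (intros n; apply HS); auto.
destruct (Hloc x y) as [delta [Hd Hg]].
{ exact (Hx 0%nat). } { exact (Hy 0%nat). }
assert (Ex : exists n, B n - A n < delta /\ D n - C n < delta).
{ pose proof (half_pow_lim (b - a + (d - c))) as L.
  apply is_lim_seq_spec in L. destruct (L (mkposreal _ Hd)) as [N HN].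
  exists N. specialize (HN N (le_n N)). simpl in HN.
  rewrite Rminus_0_r, Rmult_plus_distr_r, <- HBA, <- HDC in HN.
  apply Rabs_def2 in HN. destruct (Hrs N) as (? & ? & ? & ? & _). lra. }
destruct Ex as [n [E1 E2]].
destruct (Hrs n) as (H1 & H2 & H3 & H4 & H5). apply H5.
apply Hg; auto; try apply H1; try apply H3.
Qed.

(** The integral of the form [P dx + Q dy] around the boundary of a rectangle.
    Opposite sides are subtracted under the integral sign, so that near a point
    both integrands are close to constants. *)
Definition circulation (P Q : R -> R -> R) (a b c d : R) : R :=
  RInt (fun x => P x c - P x d) a b + RInt (fun y => Q b y - Q a y) c d.

Lemma RInt_near_const (g : R -> R) (a b k M : R) :
  a <= b -> ex_RInt g a b -> (forall t, a <= t <= b -> Rabs (g t - k) <= M) ->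
  Rabs (RInt g a b - k * (b - a)) <= M * (b - a).
Proof.
intros Hab Hg HM.
assert (E : RInt g a b - k * (b - a) = RInt (fun t => g t - k) a b).
{ pose proof (RInt_minus (V := R_CompleteNormedModule) g (fun _ => k) a b Hg
    (ex_RInt_const a b k)) as E.
  rewrite RInt_const in E. etransitivity; [|symmetry; exact E].
  unfold minus, plus, opp, scal; simpl. unfold mult; simpl. ring. }
rewrite E, (Rmult_comm M). apply abs_RInt_le_const; auto.
apply (ex_RInt_minus (V := R_NormedModule) g (fun _ => k)); auto. apply ex_RInt_const.
Qed.

Lemma differentiable_pt_lim_continuous (f : R -> R -> R) (x y lx ly : R) :
  differentiable_pt_lim f x y lx ly ->
  continuous (fun t => f t y) x /\ continuous (fun t => f x t) y.
Proof.
intros H; split; apply (ex_derive_continuous (V := R_NormedModule)).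
- exists lx. apply is_derive_Reals.
  replace lx with (lx * 1 + ly * 0) by ring.
  apply (derivable_pt_lim_comp_2d f (fun t => t) (fun _ => y)); auto.
  + apply derivable_pt_lim_id. + apply derivable_pt_lim_const.
- exists ly. apply is_derive_Reals.
  replace ly with (lx * 0 + ly * 1) by ring.
  apply (derivable_pt_lim_comp_2d f (fun _ => x) (fun t => t)); auto.
  + apply derivable_pt_lim_const. + apply derivable_pt_lim_id.
Qed.

(** The form [P dx + Q dy] is assumed closed in the pointwise sense only: the
    partial derivatives [m] of [P] in [y] and of [Q] in [x] agree, and need not be
    continuous. *)
Section Goursat.
Variables (P Q : R -> R -> R) (a b c d : R).
Hypothesis Hcl : forall x y, a <= x <= b -> c <= y <= d ->
  exists lx m ly, differentiable_pt_lim P x y lx m /\ differentiable_pt_lim Q x y m ly.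

Lemma integrable_P (s t y : R) :
  a <= s -> s <= t -> t <= b -> c <= y <= d -> ex_RInt (fun x => P x y) s t.
Proof.
intros H1 H2 H3 H4. apply (ex_RInt_continuous (V := R_CompleteNormedModule)).
rewrite Rmin_left, Rmax_right by auto. intros x Hx.
destruct (Hcl x y) as (lx & m & ly & H & _); auto; try lra.
apply differentiable_pt_lim_continuous in H. apply H.
Qed.

Lemma integrable_Q (s t x : R) :
  c <= s -> s <= t -> t <= d -> a <= x <= b -> ex_RInt (fun y => Q x y) s t.
Proof.
intros H1 H2 H3 H4. apply (ex_RInt_continuous (V := R_CompleteNormedModule)).
rewrite Rmin_left, Rmax_right by auto. intros y Hy.
destruct (Hcl x y) as (lx & m & ly & _ & H); auto; try lra.
apply differentiable_pt_lim_continuous in H. apply H.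
Qed.

Lemma circulation_quarters (a' m b' c' n d' : R) :
  a <= a' -> a' <= m -> m <= b' -> b' <= b ->
  c <= c' -> c' <= n -> n <= d' -> d' <= d ->
  circulation P Q a' b' c' d' =
  circulation P Q a' m c' n + circulation P Q m b' c' n +
  circulation P Q a' m n d' + circulation P Q m b' n d'.
Proof.
intros. unfold circulation.
assert (EP : forall s t y z, a <= s -> s <= t -> t <= b -> c <= y <= d -> c <= z <= d ->
  RInt (fun x => P x y - P x z) s t = RInt (fun x => P x y) s t - RInt (fun x => P x z) s t).
{ intros. apply (RInt_minus (V := R_CompleteNormedModule)); apply integrable_P; auto. }
assert (EQ : forall s t y z, c <= s -> s <= t -> t <= d -> a <= y <= b -> a <= z <= b ->
  RInt (fun x => Q y x - Q z x) s t = RInt (fun x => Q y x) s t - RInt (fun x => Q z x) s t).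
{ intros. apply (RInt_minus (V := R_CompleteNormedModule)); apply integrable_Q; auto. }
assert (CP : forall y, c <= y <= d -> RInt (fun x => P x y) a' b' =
  RInt (fun x => P x y) a' m + RInt (fun x => P x y) m b').
{ intros. symmetry. apply (RInt_Chasles (V := R_CompleteNormedModule)); apply integrable_P; lra. }
assert (CQ : forall x, a <= x <= b -> RInt (fun y => Q x y) c' d' =
  RInt (fun y => Q x y) c' n + RInt (fun y => Q x y) n d').
{ intros. symmetry. apply (RInt_Chasles (V := R_CompleteNormedModule)); apply integrable_Q; lra. }
rewrite !EP, !EQ by lra.
rewrite (CP c'), (CP d'), (CQ a'), (CQ b') by lra. ring.
Qed.

(** To first order the two integrals of the circulation are
    [- m * (d' - c') * (b' - a')] and its opposite, so that only the remainders
    of the differentials of [P] and [Q] are left. *)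
Lemma circulation_local (x y eps : R) : a <= x <= b -> c <= y <= d -> 0 < eps ->
  exists delta, 0 < delta /\ forall a' b' c' d',
    a <= a' -> a' <= x <= b' -> b' <= b ->
    c <= c' -> c' <= y <= d' -> d' <= d ->
    b' - a' < delta -> d' - c' < delta ->
    Rabs (circulation P Q a' b' c' d') <= eps * (b' - a' + (d' - c')) ^ 2.
Proof.
intros Hx Hy Heps.
destruct (Hcl x y Hx Hy) as (lx & m & ly & HP & HQ).
assert (He : 0 < eps / 2) by lra.
destruct (HP (mkposreal _ He)) as [d1 H1]. destruct (HQ (mkposreal _ He)) as [d2 H2].
exists (Rmin d1 d2). split. { apply Rmin_pos; apply cond_pos. }
intros a' b' c' d' A1 A2 A3 C1 C2 C3 Sx Sy.
pose proof (Rmin_l d1 d2). pose proof (Rmin_r d1 d2).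
set (D := b' - a' + (d' - c')).
assert (NP : forall u v, a' <= u <= b' -> c' <= v <= d' ->
   Rabs (P u v - P x y - (lx * (u - x) + m * (v - y))) <= eps / 2 * D).
{ intros u v Hu Hv. eapply Rle_trans; [apply H1; apply Rabs_def1; lra|].
  simpl. apply Rmult_le_compat_l; [lra|].
  apply Rmax_lub; apply Rabs_le; unfold D; lra. }
assert (NQ : forall u v, a' <= u <= b' -> c' <= v <= d' ->
   Rabs (Q u v - Q x y - (m * (u - x) + ly * (v - y))) <= eps / 2 * D).
{ intros u v Hu Hv. eapply Rle_trans; [apply H2; apply Rabs_def1; lra|].
  simpl. apply Rmult_le_compat_l; [lra|].
  apply Rmax_lub; apply Rabs_le; unfold D; lra. }
assert (IP : Rabs (RInt (fun u => P u c' - P u d') a' b' - m * (c' - d') * (b' - a'))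
   <= eps * D * (b' - a')).
{ apply RInt_near_const; [lra| |].
  - apply (ex_RInt_minus (V := R_NormedModule)); apply integrable_P; lra.
  - intros t Ht.
    assert (K1 := NP t c' ltac:(lra) ltac:(lra)). assert (K2 := NP t d' ltac:(lra) ltac:(lra)).
    apply Rabs_le_between in K1. apply Rabs_le_between in K2. apply Rabs_le. lra. }
assert (IQ : Rabs (RInt (fun v => Q b' v - Q a' v) c' d' - m * (b' - a') * (d' - c'))
   <= eps * D * (d' - c')).
{ apply RInt_near_const; [lra| |].
  - apply (ex_RInt_minus (V := R_NormedModule)); apply integrable_Q; lra.
  - intros t Ht.
    assert (K1 := NQ a' t ltac:(lra) ltac:(lra)). assert (K2 := NQ b' t ltac:(lra) ltac:(lra)).
    apply Rabs_le_between in K1. apply Rabs_le_between in K2. apply Rabs_le. lra. }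
unfold circulation.
apply Rabs_le_between in IP. apply Rabs_le_between in IQ. apply Rabs_le.
unfold D in *. nra.
Qed.

(** The local estimate compares the circulation with the square of the
    half-perimeter, whose values on the four quarters of a rectangle add up
    exactly to its value on the whole; so bisection applies. *)
Lemma goursat : a <= b -> c <= d -> circulation P Q a b c d = 0.
Proof.
intros Hab Hcd.
set (S := b - a + (d - c)).
assert (HS : forall eps, 0 < eps -> Rabs (circulation P Q a b c d) <= eps * S ^ 2).
{ intros eps Heps.
  apply (bisection_2d
    (fun a' b' c' d' => Rabs (circulation P Q a' b' c' d') <= eps * (b' - a' + (d' - c')) ^ 2));
  auto.
  - intros a' b' c' d' H1 H2 H3 H4 H5 H6 m n K1 K2 K3 K4.
    rewrite (circulation_quarters a' m b' c' n d') by (unfold m, n; lra).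
    replace ((b' - a' + (d' - c')) ^ 2) with
      ((m - a' + (n - c')) ^ 2 + (b' - m + (n - c')) ^ 2 +
       (m - a' + (d' - n)) ^ 2 + (b' - m + (d' - n)) ^ 2) by (unfold m, n; field).
    apply Rabs_le_between in K1. apply Rabs_le_between in K2.
    apply Rabs_le_between in K3. apply Rabs_le_between in K4. apply Rabs_le. lra.
  - intros x y Hx Hy. now apply circulation_local. }
apply Rabs_eq_0, Rle_antisym; [|apply Rabs_pos].
apply le_epsilon. intros eps Heps.
assert (0 <= S ^ 2) by apply pow2_ge_0.
eapply Rle_trans; [apply (HS (eps / (S ^ 2 + 1)))|].
- apply Rdiv_lt_0_compat; lra.
- unfold Rdiv. rewrite Rplus_0_l, Rmult_assoc. rewrite <- (Rmult_1_r eps) at 2.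
  apply Rmult_le_compat_l; [lra|]. apply Rmult_le_reg_l with (S ^ 2 + 1); [lra|].
  field_simplify; lra.
Qed.

End Goursat.

(** * Complex derivatives and the complex exponential *)

(** The codomain is [C] as a module over itself, the structure in which the
    product rule for [is_derive] is stated; [C_NormedModule] is a different
    structure with the same norm. *)
Definition Cdiff (f : C -> C) (z l : C) : Prop :=
  @is_derive C_AbsRing (AbsRing_NormedModule C_AbsRing) f z l.

Lemma Cdiff_of_ex_derive (f : C -> C) (z : C) :
  @ex_derive C_AbsRing C_NormedModule f z -> exists l, Cdiff f z l.
Proof.
intros [l [H1 H2]]. exists l. split.
- destruct H1 as [a b c]. constructor; auto.
- intros x Hx eps. exact (H2 x Hx eps).
Qed.

Lemma ex_derive_of_Cdiff (f : C -> C) (z l : C) :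
  Cdiff f z l -> @ex_derive C_AbsRing C_NormedModule f z.
Proof.
intros [H1 H2]. exists l. split.
- destruct H1 as [a b c]. constructor; auto.
- intros x Hx eps. exact (H2 x Hx eps).
Qed.

Lemma Cdiff_eps (f : C -> C) (z l : C) :
  Cdiff f z l <->
  forall eps, 0 < eps -> exists d, 0 < d /\ forall h, Cmod h < d ->
    Cmod (f (z + h) - f z - l * h)%C <= eps * Cmod h.
Proof.
split.
- intros [_ H] eps Heps.
  destruct (H z (fun P HP => HP) (mkposreal _ Heps)) as [d Hd].
  exists d. split. { apply cond_pos. }
  intros h Hh.
  assert (E : minus (z + h)%C z = h) by (unfold minus, plus, opp; simpl; ring).
  specialize (Hd (z + h)%C).
  unfold minus, plus, opp, scal, norm in Hd; simpl in Hd.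
  unfold minus, plus, opp, scal, norm, mult in E; simpl in E.
  unfold ball in Hd; simpl in Hd.
  unfold AbsRing_ball, abs, minus, plus, opp, scal, norm, mult in Hd; simpl in Hd.
  rewrite E in Hd. specialize (Hd Hh).
  replace (f (z + h) - f z - l * h)%C with (f (z + h) + - f z + - (h * l))%C by ring.
  exact Hd.
- intros H. split; [apply (is_linear_scal_l (K := C_AbsRing))|].
  intros x Hx.
  apply (is_filter_lim_locally_unique (V := AbsRing_NormedModule C_AbsRing)) in Hx. subst x.
  intros [eps Heps]. destruct (H eps Heps) as [d [Hd K]].
  exists (mkposreal d Hd). intros y Hy.
  unfold ball in Hy; simpl in Hy. unfold AbsRing_ball, abs, minus, plus, opp in Hy; simpl in Hy.
  unfold minus, plus, opp, scal, norm; simpl. unfold mult; simpl.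
  specialize (K (y + - z)%C Hy).
  assert (E : @eq C (z + (y + - z))%C y) by ring. rewrite E in K.
  assert (E2 : @eq C (f y + - f z + - ((y + - z) * l))%C (f y - f z - l * (y + - z))%C) by ring.
  rewrite E2. exact K.
Qed.

Lemma Cdiff_const (c z : C) : Cdiff (fun _ => c) z 0.
Proof. exact (is_derive_const (V := AbsRing_NormedModule C_AbsRing) c z). Qed.

Lemma Cdiff_id (z : C) : Cdiff (fun u => u) z 1.
Proof. exact (is_derive_id (K := C_AbsRing) z). Qed.

Lemma Cdiff_plus (f g : C -> C) (z a b : C) :
  Cdiff f z a -> Cdiff g z b -> Cdiff (fun u => f u + g u)%C z (a + b)%C.
Proof. exact (is_derive_plus (V := AbsRing_NormedModule C_AbsRing) f g z a b). Qed.

Lemma Cdiff_mult (f g : C -> C) (z a b : C) :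
  Cdiff f z a -> Cdiff g z b ->
  Cdiff (fun u => f u * g u)%C z (a * g z + f z * b)%C.
Proof.
intros H1 H2. apply (is_derive_mult (K := C_AbsRing) f g z a b); auto.
intros; apply Cmult_comm.
Qed.

Lemma Cdiff_comp (f g : C -> C) (z a b : C) :
  Cdiff f (g z) a -> Cdiff g z b -> Cdiff (fun u => f (g u)) z (a * b)%C.
Proof.
intros H1 H2. rewrite Cmult_comm.
exact (is_derive_comp (V := AbsRing_NormedModule C_AbsRing) f g z a b H1 H2).
Qed.

Lemma Cdiff_affine (a b z : C) : Cdiff (fun u => a * u + b)%C z a.
Proof.
replace (Cdiff (fun u => a * u + b)%C z a)
  with (Cdiff (fun u => a * u + b)%C z (0 * z + a * 1 + 0)%C) by (f_equal; ring).
apply Cdiff_plus, Cdiff_const.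
apply (Cdiff_mult (fun _ => a) (fun u => u)). apply Cdiff_const. apply Cdiff_id.
Qed.

Lemma Cdiff_opp (z : C) : Cdiff Copp z (- (1))%C.
Proof.
exact (is_derive_opp (V := AbsRing_NormedModule C_AbsRing) (fun u => u) z _ (Cdiff_id z)).
Qed.

Lemma im_le_Cmod (c : C) : Rabs (Im c) <= Cmod c.
Proof. eapply Rle_trans; [apply Rmax_r|apply Rmax_Cmod]. Qed.

Lemma Cmod_le_sum (x y : R) : Cmod (x, y) <= Rabs x + Rabs y.
Proof.
unfold Cmod; simpl. rewrite <- (sqrt_pow2 (Rabs x + Rabs y)).
2: { assert (H1 := Rabs_pos x); assert (H2 := Rabs_pos y); lra. }
apply sqrt_le_1_alt.
assert (H1 := Rabs_pos x); assert (H2 := Rabs_pos y).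
assert (E1 := pow2_abs x); assert (E2 := pow2_abs y). simpl in E1, E2. nra.
Qed.

Lemma cauchy_riemann (f : C -> C) (x y : R) (l : C) :
  Cdiff f (x, y) l ->
  differentiable_pt_lim (fun u v => Re (f (u, v))) x y (Re l) (- Im l) /\
  differentiable_pt_lim (fun u v => Im (f (u, v))) x y (Im l) (Re l).
Proof.
intros H. rewrite Cdiff_eps in H.
assert (K : forall eps : posreal, exists d : posreal, forall u v,
   Rabs (u - x) < d -> Rabs (v - y) < d ->
   Cmod (f (u, v) - f (x, y) - l * ((u - x)%R, (v - y)%R))%C
   <= eps * Rmax (Rabs (u - x)) (Rabs (v - y))).
{ intros eps. destruct (H (eps / 2)) as [d [Hd K]].
  { destruct eps; simpl; lra. }
  assert (Hd2 : 0 < d / 2) by lra.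
  exists (mkposreal _ Hd2). simpl. intros u v Hu Hv.
  assert (B := Cmod_le_sum (u - x) (v - y)).
  assert (M1 := Rmax_l (Rabs (u - x)) (Rabs (v - y))).
  assert (M2 := Rmax_r (Rabs (u - x)) (Rabs (v - y))).
  specialize (K (u - x, v - y)).
  replace ((x, y) + ((u - x)%R, (v - y)%R))%C with ((u, v) : C) in K
    by (unfold Cplus; simpl; f_equal; ring).
  eapply Rle_trans; [apply K; lra|].
  destruct eps as [eps He]; simpl. nra. }
split; intros eps; destruct (K eps) as [d Hd]; exists d; intros u v Hu Hv;
(eapply Rle_trans; [|apply (Hd u v Hu Hv)]).
- eapply Rle_trans; [|apply re_le_Cmod]. right. f_equal.
  destruct (f (u, v)), (f (x, y)), l; simpl. ring.
- eapply Rle_trans; [|apply im_le_Cmod]. right. f_equal.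
  destruct (f (u, v)), (f (x, y)), l; simpl. ring.
Qed.

(** The exponential is given by its polar form, since only the polar coordinates
    of its values and the functional equation matter below. *)
Definition Cexponential (u : C) : C := (exp (Re u) * cos (Im u), exp (Re u) * sin (Im u)).

Lemma Cexponential_plus (u v : C) :
  Cexponential (u + v) = (Cexponential u * Cexponential v)%C.
Proof.
destruct u as [a b], v as [c d]. unfold Cexponential, Cplus, Cmult; simpl.
rewrite exp_plus, cos_plus, sin_plus. apply injective_projections; simpl; ring.
Qed.

Lemma Cmod_Cexponential (u : C) : Cmod (Cexponential u) = exp (Re u).
Proof.
destruct u as [x y]. unfold Cexponential, Cmod; simpl.
assert (E := sin2_cos2 y). unfold Rsqr in E. assert (P := exp_pos x).
transitivity (sqrt (exp x ^ 2)); [f_equal|apply sqrt_pow2; lra].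
transitivity (exp x ^ 2 * (sin y * sin y + cos y * cos y)); [ring|].
rewrite E. ring.
Qed.

Lemma derivable_pt_lim_eps (f : R -> R) (x l eps : R) :
  derivable_pt_lim f x l -> 0 < eps ->
  exists d, 0 < d /\ forall h, Rabs h < d -> Rabs (f (x + h) - f x - l * h) <= eps * Rabs h.
Proof.
intros H He. destruct (H eps He) as [d Hd]. exists d. split; [apply cond_pos|].
intros h Hh. destruct (Req_dec h 0) as [->|Hz].
- rewrite Rplus_0_r. replace (f x - f x - l * 0) with 0 by ring. rewrite Rabs_R0. lra.
- specialize (Hd h Hz Hh).
  replace (f (x + h) - f x - l * h) with (((f (x + h) - f x) / h - l) * h) by (field; auto).
  rewrite Rabs_mult. apply Rmult_le_compat_r; [apply Rabs_pos|lra].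
Qed.

(** The functional equation reduces the claim to the point [0]. *)
Lemma Cdiff_Cexponential (u : C) : Cdiff Cexponential u (Cexponential u).
Proof.
assert (H0 : Cdiff Cexponential 0 1).
{ apply Cdiff_eps. intros eps Heps.
  (* With [e <= 1], the errors of [exp], [cos] and [sin] add up to at most
     [6 * e * Cmod h]. *)
  set (e := Rmin 1 (eps / 8)).
  assert (He : 0 < e) by (apply Rmin_pos; lra).
  assert (He1 : e <= 1) by apply Rmin_l. assert (He2 : e <= eps / 8) by apply Rmin_r.
  destruct (derivable_pt_lim_eps exp 0 1 e) as [d1 [D1 H1]]; auto.
  { rewrite <- exp_0. apply derivable_pt_lim_exp. }
  destruct (derivable_pt_lim_eps cos 0 0 e) as [d2 [D2 H2]]; auto.
  { assert (E := derivable_pt_lim_cos 0). now rewrite sin_0, Ropp_0 in E. }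
  destruct (derivable_pt_lim_eps sin 0 1 e) as [d3 [D3 H3]]; auto.
  { rewrite <- cos_0. apply derivable_pt_lim_sin. }
  exists (Rmin (Rmin d1 d2) (Rmin d3 (e / 2))). split.
  { repeat apply Rmin_pos; lra. }
  intros [s t] Hh.
  assert (M1 := Rmin_l (Rmin d1 d2) (Rmin d3 (e / 2))).
  assert (M2 := Rmin_r (Rmin d1 d2) (Rmin d3 (e / 2))).
  assert (M3 := Rmin_l d1 d2). assert (M4 := Rmin_r d1 d2).
  assert (M5 := Rmin_l d3 (e / 2)). assert (M6 := Rmin_r d3 (e / 2)).
  assert (S := re_le_Cmod (s, t)). assert (T := im_le_Cmod (s, t)). simpl in S, T.
  specialize (H1 s ltac:(lra)). specialize (H2 t ltac:(lra)). specialize (H3 t ltac:(lra)).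
  rewrite Rplus_0_l in *. rewrite exp_0 in H1. rewrite cos_0 in H2. rewrite sin_0 in H3.
  replace (Cexponential (0 + (s, t)) - Cexponential 0 - 1 * (s, t))%C with
    ((exp s * (cos t - 1 - 0 * t) + (exp s - 1 - 1 * s),
      exp s * (sin t - 0 - 1 * t) + (exp s - 1) * t) : C).
  2: { unfold Cexponential; simpl. rewrite !Rplus_0_l, exp_0, cos_0, sin_0.
       unfold Cminus, Cplus, Copp, Cmult; simpl. f_equal; ring. }
  set (m := Cmod (s, t)) in *.
  assert (Hm : 0 <= m) by apply Cmod_ge_0.
  assert (E1 : Rabs (exp s - 1) <= e).
  { replace (exp s - 1) with ((exp s - 1 - 1 * s) + s) by ring.
    eapply Rle_trans; [apply Rabs_triang|]. nra. }
  assert (E2 : Rabs (exp s) <= 2).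
  { replace (exp s) with ((exp s - 1) + 1) by ring.
    eapply Rle_trans; [apply Rabs_triang|]. rewrite Rabs_R1. lra. }
  assert (P1 := Rabs_pos (exp s)). assert (P2 := Rabs_pos (exp s - 1)).
  eapply Rle_trans; [apply Cmod_le_sum|].
  eapply Rle_trans; [apply Rplus_le_compat; apply Rabs_triang|]. rewrite !Rabs_mult.
  assert (B2 : Rabs (exp s) * Rabs (cos t - 1 - 0 * t) <= 2 * (e * m)).
  { apply Rmult_le_compat; auto using Rabs_pos. eapply Rle_trans; [exact H2|].
    apply Rmult_le_compat_l; lra. }
  assert (B3 : Rabs (exp s) * Rabs (sin t - 0 - 1 * t) <= 2 * (e * m)).
  { apply Rmult_le_compat; auto using Rabs_pos. eapply Rle_trans; [exact H3|].
    apply Rmult_le_compat_l; lra. }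
  assert (B4 : Rabs (exp s - 1) * Rabs t <= e * m).
  { apply Rmult_le_compat; auto using Rabs_pos. }
  assert (B1 : Rabs (exp s - 1 - 1 * s) <= e * m).
  { eapply Rle_trans; [exact H1|]. apply Rmult_le_compat_l; lra. }
  nra. }
apply Cdiff_eps. rewrite Cdiff_eps in H0. intros eps Heps.
assert (P := exp_pos (Re u)).
destruct (H0 (eps / exp (Re u))) as [d [Hd K]]. { now apply Rdiv_lt_0_compat. }
exists d; split; auto. intros h Hh. specialize (K h Hh).
replace (Cexponential (u + h) - Cexponential u - Cexponential u * h)%C with
  (Cexponential u * (Cexponential (0 + h) - Cexponential 0 - 1 * h))%C.
2: { rewrite !Cexponential_plus. unfold Cexponential at 2 4; simpl.
     rewrite exp_0, cos_0, sin_0.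
     replace ((1 * 1, 1 * 0) : C) with (RtoC 1) by (unfold RtoC; f_equal; ring). ring. }
rewrite Cmod_mult, Cmod_Cexponential.
replace (eps * Cmod h) with (exp (Re u) * (eps / exp (Re u) * Cmod h)) by (field; lra).
apply Rmult_le_compat_l; lra.
Qed.

(** * The Schwarz--Pick inequality for derivatives *)

(** Over one period, the integrals of [F] along the two horizontal sides of the
    rectangle cancel; by Goursat's theorem the mean of [Re F] over a vertical
    period is thus the same on both edges of the strip. *)
Lemma periodic_strip_mean (F : C -> C) (x1 x2 m M : R) :
  x1 <= x2 ->
  (forall u, x1 <= Re u <= x2 -> exists l, Cdiff F u l) ->
  (forall x, F (x, 2 * PI) = F (x, 0)) ->
  (forall y, Re (F (x1, y)) <= M) -> (forall y, m <= Re (F (x2, y))) -> m <= M.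
Proof.
intros H12 Hd Hper HM Hm.
(* [P dx + Q dy] is the imaginary part of [F du]. *)
set (P := fun x y => Im (F (x, y))). set (Q := fun x y => Re (F (x, y))).
assert (Pp := PI_RGT_0).
assert (Hcl : forall x y, x1 <= x <= x2 -> 0 <= y <= 2 * PI -> exists lx k ly,
   differentiable_pt_lim P x y lx k /\ differentiable_pt_lim Q x y k ly).
{ intros x y Hx _. destruct (Hd (x, y) Hx) as [l Hl].
  apply cauchy_riemann in Hl. exists (Im l), (Re l), (- Im l). tauto. }
assert (G := goursat P Q x1 x2 0 (2 * PI) Hcl H12 ltac:(lra)).
unfold circulation in G.
assert (Z : RInt (fun x => P x 0 - P x (2 * PI)) x1 x2 = 0).
{ rewrite (RInt_ext _ (fun _ => 0)).
  - rewrite RInt_const. unfold scal; simpl. unfold mult; simpl. ring.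
  - intros x _. unfold P. rewrite Hper. now apply Rminus_diag_eq. }
assert (I : forall x, x1 <= x <= x2 -> ex_RInt (Q x) 0 (2 * PI)).
{ intros x Hx. apply (integrable_Q P Q x1 x2 0 (2 * PI) Hcl); lra. }
assert (S : RInt (fun y => Q x2 y - Q x1 y) 0 (2 * PI) =
   RInt (Q x2) 0 (2 * PI) - RInt (Q x1) 0 (2 * PI)).
{ apply (RInt_minus (V := R_CompleteNormedModule)); apply I; lra. }
assert (C : forall k, RInt (fun _ => k) 0 (2 * PI) = k * (2 * PI)).
{ intros k. rewrite RInt_const. unfold scal; simpl. unfold mult; simpl. ring. }
assert (L1 : RInt (Q x1) 0 (2 * PI) <= M * (2 * PI)).
{ rewrite <- C. apply RInt_le; try lra. apply I; lra. apply ex_RInt_const.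
  intros; apply HM. }
assert (L2 : m * (2 * PI) <= RInt (Q x2) 0 (2 * PI)).
{ rewrite <- C. apply RInt_le; try lra. apply ex_RInt_const. apply I; lra.
  intros; apply Hm. }
apply Rmult_le_reg_r with (2 * PI); lra.
Qed.

Lemma Cexponential_opp (u : C) : (Cexponential u * Cexponential (- u))%C = 1.
Proof.
rewrite <- Cexponential_plus. replace (u + - u)%C with (RtoC 0) by ring.
unfold Cexponential; simpl. rewrite exp_0, cos_0, sin_0.
unfold RtoC. f_equal; ring.
Qed.

(** Let [c = p + i q] be of modulus 1.  In the coordinate [z = exp u], the function
    [g z * (1 + c z + conj c / (4 z))] is periodic.  On [|z| = 1/2] the second
    factor is [1 + 2 Re (c z)], which is real and nonnegative, so that the lower
    bound on [Re g] gives one on the real part of the product.  As [z] tends to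
    [0] the product tends to [conj c * l / 4], because [g 0 = 0].  Comparing the
    means on the two circles gives a lower bound on [Re (conj c * l)]. *)
Section Kernel.
Variables (g : C -> C) (l : C) (p q : R).
Hypothesis g_diff : forall z, Cmod z < 1 -> exists k, Cdiff g z k.
Hypothesis g_zero : g 0 = 0.
Hypothesis g_re : forall z, Cmod z < 1 -> -1 <= Re (g z).
Hypothesis g_der : Cdiff g 0 l.
Hypothesis pq_unit : p ^ 2 + q ^ 2 = 1.

Let cc : C := (p / 4, - q / 4).

Let F (u : C) : C :=
  (g (Cexponential u) *
   (1 + ((p, q) * Cexponential u + cc * Cexponential (- u))))%C.

Lemma weighted_diff (u : C) : Re u < 0 -> exists k, Cdiff F u k.
Proof.
intros Hu.
destruct (g_diff (Cexponential u)) as [k Hk].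
{ rewrite Cmod_Cexponential, <- exp_0. now apply exp_increasing. }
eexists. unfold F.
apply (Cdiff_mult (fun u => g (Cexponential u))).
- apply (Cdiff_comp g); [exact Hk|apply Cdiff_Cexponential].
- apply (Cdiff_plus (fun _ => RtoC 1)); [apply Cdiff_const|].
  apply (Cdiff_plus (fun u => (p, q) * Cexponential u)%C
                    (fun u => cc * Cexponential (- u))%C).
  + apply (Cdiff_mult (fun _ => (p, q)) Cexponential);
      [apply Cdiff_const|apply Cdiff_Cexponential].
  + apply (Cdiff_mult (fun _ => cc) (fun u => Cexponential (- u)%C));
      [apply Cdiff_const|].
    apply (Cdiff_comp Cexponential Copp); [apply Cdiff_Cexponential|apply Cdiff_opp].
Qed.

Lemma weighted_periodic (x : R) : F (x, 2 * PI) = F (x, 0).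
Proof.
unfold F.
assert (E1 : Cexponential (x, 2 * PI) = Cexponential (x, 0)).
{ unfold Cexponential; simpl. now rewrite cos_2PI, sin_2PI, cos_0, sin_0. }
assert (E2 : Cexponential (- (x, (2 * PI)%R)) = Cexponential (- (x, 0%R))).
{ unfold Cexponential; simpl.
  now rewrite !cos_neg, !sin_neg, cos_2PI, sin_2PI, cos_0, sin_0. }
now rewrite E1, E2.
Qed.

Lemma weighted_right (y : R) : -2 <= Re (F (ln (1 / 2), y)).
Proof.
set (k := p * cos y - q * sin y).
assert (E : Re (F (ln (1 / 2), y)) = Re (g (Cexponential (ln (1 / 2), y))) * (1 + k)).
{ unfold F, cc. generalize (g (Cexponential (ln (1 / 2), y))). intros [s t].
  unfold Cexponential; simpl.
  rewrite exp_Ropp, exp_ln, cos_neg, sin_neg by lra. unfold k. field. }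
rewrite E.
assert (G : -1 <= Re (g (Cexponential (ln (1 / 2), y)))).
{ apply g_re. rewrite Cmod_Cexponential; simpl. rewrite exp_ln; lra. }
assert (S := sin2_cos2 y). unfold Rsqr in S.
assert (Hk : -1 <= k <= 1).
{ assert (k ^ 2 <= 1).
  { assert (k ^ 2 + (p * sin y + q * cos y) ^ 2 = 1).
    { unfold k. transitivity ((p ^ 2 + q ^ 2) * (sin y * sin y + cos y * cos y)); [ring|].
      rewrite S, pq_unit. ring. }
    assert (0 <= (p * sin y + q * cos y) ^ 2) by apply pow2_ge_0. lra. }
  nra. }
nra.
Qed.

Lemma weighted_left (eps : R) : 0 < eps <= 1 -> exists x, x <= ln (1 / 2) /\
  forall y, Re (F (x, y)) <= (Re l * p + Im l * q) / 4 + eps.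
Proof.
intros He.
destruct (proj1 (Cdiff_eps g 0 l) g_der eps) as [d [Hd K]]; [lra|].
assert (Hl := Cmod_ge_0 l).
set (r := Rmin (1 / 2) (Rmin (d / 2) (eps / (4 * (Cmod l + 1))))).
assert (Hr : 0 < r).
{ repeat apply Rmin_pos; try lra. apply Rdiv_lt_0_compat; lra. }
assert (R1 : r <= 1 / 2) by apply Rmin_l.
assert (R2 : r <= d / 2). { eapply Rle_trans; [apply Rmin_r|apply Rmin_l]. }
assert (R3 : r * (Cmod l + 1) <= eps / 4).
{ assert (r <= eps / (4 * (Cmod l + 1))). { eapply Rle_trans; [apply Rmin_r|apply Rmin_r]. }
  apply Rle_trans with (eps / (4 * (Cmod l + 1)) * (Cmod l + 1)).
  - apply Rmult_le_compat_r; lra. - right. field. lra. }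
clearbody r.
exists (ln r). split.
{ destruct (Req_dec r (1 / 2)) as [->|]; [lra|]. left; apply ln_increasing; lra. }
intros y. set (z := Cexponential (ln r, y)). set (w := Cexponential (- (ln r, y))).
assert (Hz : Cmod z = r). { unfold z. rewrite Cmod_Cexponential; simpl. now apply exp_ln. }
assert (Hw : Cmod w = / r).
{ unfold w. rewrite Cmod_Cexponential; simpl. now rewrite exp_Ropp, exp_ln. }
assert (Hzw : (z * w)%C = 1) by apply Cexponential_opp.
specialize (K z ltac:(lra)). rewrite Cplus_0_l, g_zero in K.
assert (U : Cmod (p, q) = 1).
{ unfold Cmod; simpl fst; simpl snd. rewrite pq_unit. apply sqrt_1. }
assert (V : Cmod cc = 1 / 4).
{ unfold Cmod, cc; simpl fst; simpl snd.
  replace ((p / 4) ^ 2 + (- q / 4) ^ 2) with ((p ^ 2 + q ^ 2) * (1 / 4) ^ 2) by field.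
  rewrite pq_unit, Rmult_1_l. apply sqrt_pow2. lra. }
(* Since [z * w = 1], the singular factor [w] meets only the quotient
   [g z / z], which differs from [l] by at most [eps]. *)
assert (E : F (ln r, y) = (l * cc +
   (g z * (1 + (p, q) * z) + cc * ((g z - 0 - l * z) * w)))%C).
{ unfold F. fold z w.
  replace (l * cc)%C with (l * cc * (z * w))%C
    by (rewrite Hzw; ring). ring. }
rewrite E, re_plus.
assert (B : Cmod (g z * (1 + (p, q) * z) + cc * ((g z - 0 - l * z) * w))%C <= eps).
{ eapply Rle_trans; [apply Cmod_triangle|]. rewrite !Cmod_mult, V, Hw.
  assert (B1 : Cmod (g z) <= r * (Cmod l + 1)).
  { replace (g z) with ((g z - 0 - l * z) + l * z)%C by ring.
    eapply Rle_trans; [apply Cmod_triangle|]. rewrite Cmod_mult, Hz in *. nra. }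
  assert (B2 : Cmod (1 + (p, q) * z)%C <= 2).
  { eapply Rle_trans; [apply Cmod_triangle|]. rewrite Cmod_mult, U, Hz, Cmod_1. lra. }
  assert (B3 : Cmod (g z - 0 - l * z)%C * / r <= eps).
  { rewrite Hz in K. apply Rmult_le_reg_r with r; auto. field_simplify; lra. }
  assert (B4 := Cmod_ge_0 (g z)).
  assert (Cmod (g z) * Cmod (1 + (p, q) * z)%C <= eps / 4 * 2).
  { apply Rmult_le_compat; try apply Cmod_ge_0; lra. }
  lra. }
assert (B' := re_le_Cmod (g z * (1 + (p, q) * z) + cc * ((g z - 0 - l * z) * w))%C).
apply Rabs_le_between in B'.
rewrite re_mult. replace (Re cc) with (p / 4) by reflexivity.
replace (Im cc) with (- q / 4) by reflexivity. lra.
Qed.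

Lemma weighted_bound : -8 <= Re l * p + Im l * q.
Proof.
cut (-2 <= (Re l * p + Im l * q) / 4); [lra|].
apply le_epsilon. intros eps Heps.
destruct (weighted_left (Rmin eps 1)) as [x [Hx HF]].
{ split. apply Rmin_pos; lra. apply Rmin_r. }
assert (M := Rmin_l eps 1).
apply Rle_trans with ((Re l * p + Im l * q) / 4 + Rmin eps 1); [|lra].
apply (periodic_strip_mean F x (ln (1 / 2))); auto.
- intros u Hu. apply weighted_diff.
  assert (ln (1 / 2) < 0) by (rewrite <- ln_1; apply ln_increasing; lra). lra.
- apply weighted_periodic.
- apply weighted_right.
Qed.
End Kernel.

(** The value of the constant is immaterial: it disappears when the estimate is
    applied to iterates. *)
Lemma borel_caratheodory_derivative (g : C -> C) (l : C) :
  (forall z, Cmod z < 1 -> exists k, Cdiff g z k) ->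
  g 0 = 0 -> (forall z, Cmod z < 1 -> -1 <= Re (g z)) -> Cdiff g 0 l ->
  Cmod l <= 8.
Proof.
intros H1 H2 H3 H4.
destruct (Rle_lt_dec (Cmod l) 0) as [|Hl]; [lra|].
assert (E := Cmod2_alt l).
(* With [c = - l / |l|], the quantity [Re (conj c * l)] is [- |l|]. *)
assert (K := weighted_bound g l (- Re l / Cmod l) (- Im l / Cmod l) H1 H2 H3 H4).
assert (U : (- Re l / Cmod l) ^ 2 + (- Im l / Cmod l) ^ 2 = 1).
{ transitivity ((Re l ^ 2 + Im l ^ 2) / Cmod l ^ 2); [field; lra|].
  rewrite <- E. field. lra. }
specialize (K U).
replace (Re l * (- Re l / Cmod l) + Im l * (- Im l / Cmod l)) with
  (- ((Re l ^ 2 + Im l ^ 2) / Cmod l)) in K by (field; lra).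
rewrite <- E in K. replace (Cmod l ^ 2 / Cmod l) with (Cmod l) in K by (field; lra).
lra.
Qed.

Lemma iterate_self_map (f : C -> C) (n : nat) :
  holomorphic_self_map f -> holomorphic_self_map (iterate f n).
Proof.
intros [H1 H2]. induction n as [|n [I1 I2]]; split; intros z Hz; simpl.
- exact Hz.
- apply (ex_derive_of_Cdiff _ z 1), Cdiff_id.
- apply H1, I1, Hz.
- destruct (Cdiff_of_ex_derive _ _ (I2 z Hz)) as [b Hb].
  destruct (Cdiff_of_ex_derive _ _ (H2 _ (I1 z Hz))) as [a Ha].
  apply (ex_derive_of_Cdiff _ z (a * b)%C). now apply (Cdiff_comp f).
Qed.

Lemma iterate_fixed_diff (f : C -> C) (z l : C) (n : nat) :
  f z = z -> Cdiff f z l -> iterate f n z = z /\ Cdiff (iterate f n) z (l ^ n)%C.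
Proof.
intros Hz Hl. induction n as [|n [I1 I2]]; simpl; split; auto.
- apply Cdiff_id.
- change (f (iterate f n z) = z). now rewrite I1.
- apply (Cdiff_comp f (iterate f n)); auto. now rewrite I1.
Qed.

(** All iterates of [f] are self-maps fixing [1], with derivatives [l ^ n] there;
    a bound on these that is uniform in [n] forces [Cmod l <= 1]. *)
Lemma fixed_point_derivative_le_1 (f : C -> C) (l : C) :
  holomorphic_self_map f -> f 1 = 1 -> Cdiff f 1 l -> Cmod l <= 1.
Proof.
intros Hf H1 Hl. apply Rnot_lt_le; intros Hgt.
assert (B : forall n, Cmod l ^ n <= 8).
{ intros n. rewrite <- Cmod_pow.
  destruct (iterate_self_map f n Hf) as [S D].
  destruct (iterate_fixed_diff f 1 l n H1 Hl) as [E I].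
  assert (sh : forall z, Cdiff (fun z => 1 + z)%C z 1).
  { intros z. assert (A := Cdiff_affine 1 1 z).
    eapply (is_derive_ext (V := AbsRing_NormedModule C_AbsRing)); [|exact A].
    intros t. simpl. apply injective_projections; simpl; ring. }
  assert (Hp : forall z, Cmod z < 1 -> RHP (1 + z)%C).
  { intros z Hz. assert (R := re_le_Cmod z). apply Rabs_le_between in R.
    unfold RHP. rewrite re_plus, re_RtoC. lra. }
  assert (dg : forall z k, Cdiff (iterate f n) (1 + z)%C k ->
     Cdiff (fun z => iterate f n (1 + z) + (-1))%C z (k * 1 + 0)%C).
  { intros z k Hk. apply Cdiff_plus; [|apply Cdiff_const].
    now apply (Cdiff_comp (iterate f n)). }
  apply (borel_caratheodory_derivative (fun z => iterate f n (1 + z) + (-1))%C).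
  - intros z Hz. destruct (Cdiff_of_ex_derive _ _ (D _ (Hp z Hz))) as [k Hk].
    eexists. now apply dg with (k := k).
  - rewrite Cplus_0_r, E. apply injective_projections; simpl; ring.
  - intros z Hz. specialize (S _ (Hp z Hz)). unfold RHP in S.
    rewrite re_plus, re_RtoC. lra.
  - replace (l ^ n)%C with (l ^ n * 1 + 0)%C by ring. apply dg.
    now rewrite Cplus_0_r. }
destruct (Pow_x_infinity (Cmod l)) with (b := 9) as [N HN].
{ rewrite Rabs_pos_eq; lra. }
specialize (HN N (le_n N)). specialize (B N).
rewrite Rabs_pos_eq in HN. lra. apply pow_le; lra.
Qed.

(** Affine maps of the half-plane act transitively, so [f] can be composed with
    such maps on both sides to become a self-map fixing [1]. *)
Lemma schwarz_pick_derivative (f : C -> C) (z l : C) :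
  holomorphic_self_map f -> RHP z -> Cdiff f z l ->
  Cmod l * Re z <= Re (f z).
Proof.
intros [S D] Hz Hl. assert (Hf := S z Hz).
set (x := Re z) in *. set (u := Re (f z)) in *.
unfold RHP in Hz, Hf. fold x in Hz. fold u in Hf.
pose (pre := fun s : C => (x * s + (0, Im z)%R)%C).
pose (post := fun s : C => (RtoC (/ u) * s + (0, - Im (f z) / u)%R)%C).
assert (Hpre : forall s, RHP s -> RHP (pre s)).
{ intros s Hs. unfold RHP, pre in *. destruct s as [s t]; simpl in *. nra. }
assert (Hpost : forall s, RHP s -> RHP (post s)).
{ intros s Hs. unfold RHP, post in *. destruct s as [s t]; simpl in *.
  assert (0 < / u) by now apply Rinv_0_lt_compat. nra. }
assert (P1 : pre 1 = z). { unfold pre, x. destruct z; simpl.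
  apply injective_projections; simpl; ring. }
assert (dA : forall s k, Cdiff f (pre s) k ->
   Cdiff (fun s => post (f (pre s))) s (RtoC (/ u) * (k * x))%C).
{ intros s k Hk. apply (Cdiff_comp post (fun s => f (pre s))). apply Cdiff_affine.
  apply (Cdiff_comp f pre); auto. apply Cdiff_affine. }
assert (B : Cmod (RtoC (/ u) * (l * x))%C <= 1).
{ apply (fixed_point_derivative_le_1 (fun s => post (f (pre s)))).
  - split; intros s Hs. { auto. }
    destruct (Cdiff_of_ex_derive _ _ (D _ (Hpre s Hs))) as [k Hk].
    exact (ex_derive_of_Cdiff _ _ _ (dA _ _ Hk)).
  - rewrite P1. unfold post. fold u. assert (Eu : Re (f z) = u) by reflexivity.
    destruct (f z) as [v w]; simpl in *.
    apply injective_projections; simpl; rewrite ?Eu; field; lra.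
  - apply dA. now rewrite P1. }
rewrite !Cmod_mult, !Cmod_R, !Rabs_pos_eq in B; try lra.
2: { left; now apply Rinv_0_lt_compat. }
apply Rmult_le_reg_l with (/ u). { now apply Rinv_0_lt_compat. }
rewrite Rinv_l; lra.
Qed.

(** * Julia's lemma and the Lipschitz behaviour of self-maps *)

Lemma nonincreasing_of_derive (phi dphi : R -> R) (a b : R) :
  a <= b -> (forall x, a <= x <= b -> is_derive phi x (dphi x)) ->
  (forall x, a <= x <= b -> dphi x <= 0) -> phi b <= phi a.
Proof.
intros Hab Hd Hn.
destruct (MVT_gen phi a b dphi) as [c [Hc E]];
  rewrite ?Rmin_left, ?Rmax_right in * by auto.
- intros x Hx. apply Hd. lra.
- intros x Hx. apply derivable_continuous_pt. exists (dphi x). apply is_derive_Reals. now apply Hd.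
- specialize (Hn c Hc). nra.
Qed.

Lemma holomorphic_derivative (f : C -> C) : holomorphic_self_map f ->
  exists df : C -> C, forall z, RHP z -> Cdiff f z (df z).
Proof.
intros [_ D]. exists (fun z => epsilon (inhabits (RtoC 0)) (Cdiff f z)).
intros z Hz. apply epsilon_spec. now apply Cdiff_of_ex_derive, D.
Qed.

(** This lets complex derivatives be used in the real mean value theorem. *)
Lemma Cdiff_along_line (f : C -> C) (p v l : C) (s : R) :
  Cdiff f (p + s * v)%C l ->
  is_derive (fun t : R => Re (f (p + t * v)%C)) s (Re (l * v)%C) /\
  is_derive (fun t : R => Im (f (p + t * v)%C)) s (Im (l * v)%C).
Proof.
destruct p as [p1 p2], v as [v1 v2]. intros H.
assert (E : forall t : R, ((p1, p2) + t * (v1, v2))%C = (p1 + t * v1, p2 + t * v2) :> C).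
{ intros t. apply injective_projections; simpl; ring. }
rewrite E in H. apply cauchy_riemann in H. destruct H as [H1 H2].
assert (A : forall a b : R, derivable_pt_lim (fun t => a + t * b) s b).
{ intros a b. apply is_derive_Reals. auto_derive; auto. ring. }
split; apply is_derive_Reals;
(eapply derivable_pt_lim_ext; [intros t; now rewrite E|]).
- replace (Re (l * (v1, v2))%C) with (Re l * v1 + - Im l * v2) by (destruct l; simpl; ring).
  exact (derivable_pt_lim_comp_2d _ _ _ _ _ _ _ _ H1 (A p1 v1) (A p2 v2)).
- replace (Im (l * (v1, v2))%C) with (Im l * v1 + Re l * v2) by (destruct l; simpl; ring).
  exact (derivable_pt_lim_comp_2d _ _ _ _ _ _ _ _ H2 (A p1 v1) (A p2 v2)).
Qed.

(** The derivative of [Re f] along the ray is at most [Re f / Re], by the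
    Schwarz--Pick inequality: the logarithmic derivative of [Re f] does not exceed
    that of [Re]. *)
Lemma self_map_ratio_decreasing (f : C -> C) (z : C) (t : R) :
  holomorphic_self_map f -> RHP z -> 0 <= t ->
  Re (f (z + t)%C) / (Re z + t) <= Re (f z) / Re z.
Proof.
intros Hf Hz Ht. destruct (holomorphic_derivative f Hf) as [df Hdf].
assert (Hr : forall s, 0 <= s -> RHP (z + s * 1)%C /\ Re (z + s * 1)%C = Re z + s).
{ intros s Hs. unfold RHP in *. rewrite re_plus, re_scal_l, re_RtoC. lra. }
unfold RHP in Hz.
pose (phi := fun s : R => Re (f (z + s * 1)%C) / (Re z + s)).
pose (dphi := fun s : R =>
  (Re (df (z + s * 1)%C * 1)%C * (Re z + s) - Re (f (z + s * 1)%C)) / (Re z + s) ^ 2).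
assert (L : phi t <= phi 0).
{ apply (nonincreasing_of_derive phi dphi); auto.
  - intros s [Hs _]. unfold phi, dphi. destruct (Hr s Hs) as [Hr1 Hr2].
    destruct (Cdiff_along_line f z 1 _ s (Hdf _ Hr1)) as [D _].
    assert (D2 : is_derive (fun s : R => Re z + s) s 1) by (auto_derive; auto).
    replace (_ / _) with
      ((Re (df (z + s * 1) * 1)%C * (Re z + s) - Re (f (z + s * 1)%C) * 1) / (Re z + s) ^ 2)
      by (f_equal; ring).
    apply (is_derive_div _ _ s _ _ D D2). lra.
  - intros s [Hs _]. unfold dphi. destruct (Hr s Hs) as [Hr1 Hr2].
    assert (SP := schwarz_pick_derivative f _ _ Hf Hr1 (Hdf _ Hr1)). rewrite Hr2 in SP.
    rewrite Cmult_1_r. assert (RC := re_le_Cmod (df (z + s * 1)%C)). apply Rabs_le_between in RC.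
    assert (P : 0 < (Re z + s) ^ 2) by (apply pow_lt; lra).
    apply Rmult_le_reg_r with ((Re z + s) ^ 2); auto.
    unfold Rdiv. rewrite Rmult_assoc, Rinv_l, Rmult_0_l by lra. nra. }
unfold phi in L. rewrite !Cmult_1_r, Rplus_0_r, Cplus_0_r in L. exact L.
Qed.

(** Along the segment from [p] to [p'], the Schwarz--Pick inequality bounds the
    speed of the image curve by [L * Re], with [L] independent of [F].  Hence [Re F]
    grows at most by the factor [exp L] (Gronwall), and [Im F] varies by at most
    [L * exp L * Re (F p)].  The uniformity in [F] is the point: it is applied to
    all iterates of a map. *)
Lemma im_variation_bound (p p' : C) : RHP p -> RHP p' ->
  exists K, 0 <= K /\ forall F, holomorphic_self_map F ->
    Rabs (Im (F p') - Im (F p)) <= K * Re (F p).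
Proof.
intros Hp Hp'. unfold RHP in Hp, Hp'.
set (v := (p' - p)%C). set (m := Rmin (Re p) (Re p')).
assert (Hm : 0 < m) by now apply Rmin_pos.
set (L := Cmod v / m).
assert (HL : 0 <= L). { apply Rmult_le_pos. apply Cmod_ge_0. left; now apply Rinv_0_lt_compat. }
assert (Lm : Cmod v = L * m) by (unfold L; field; lra).
exists (L * exp L). split. { apply Rmult_le_pos; auto. left; apply exp_pos. }
intros F HF. destruct (holomorphic_derivative F HF) as [dF HdF].
assert (Hr : forall s, 0 <= s <= 1 -> m <= Re (p + s * v)%C).
{ intros s Hs. unfold v. rewrite re_plus, re_scal_l. unfold Cminus. rewrite re_plus, re_opp.
  assert (m <= Re p) by apply Rmin_l. assert (m <= Re p') by apply Rmin_r. nra. }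
assert (HR : forall s, 0 <= s <= 1 -> RHP (p + s * v)%C).
{ intros s Hs. specialize (Hr s Hs). unfold RHP. lra. }
pose (phi := fun s : R => Re (F (p + s * v)%C)).
assert (Hb : forall s, 0 <= s <= 1 -> Cmod (dF (p + s * v) * v)%C <= L * phi s).
{ intros s Hs. assert (SP := schwarz_pick_derivative F _ _ HF (HR s Hs) (HdF _ (HR s Hs))).
  fold (phi s) in SP. rewrite Cmod_mult, Lm. specialize (Hr s Hs).
  assert (C0 := Cmod_ge_0 (dF (p + s * v)%C)).
  replace (Cmod (dF (p + s * v)%C) * (L * m)) with (L * (Cmod (dF (p + s * v)%C) * m)) by ring.
  apply Rmult_le_compat_l; [exact HL|].
  eapply Rle_trans; [|exact SP]. now apply Rmult_le_compat_l. }
assert (G : forall s, 0 <= s <= 1 -> phi s <= exp L * phi 0).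
{ intros s Hs.
  assert (P0 : 0 < phi 0). { apply HF, HR. lra. }
  (* Gronwall: [phi' <= L * phi]. *)
  assert (Q : phi s * exp (- L * s) <= phi 0 * exp (- L * 0)).
  { apply (nonincreasing_of_derive (fun s => phi s * exp (- L * s))
      (fun s => Re (dF (p + s * v) * v)%C * exp (- L * s) +
        phi s * (- L * exp (- L * s)))); [lra| |].
    - intros x Hx. assert (Hx' : 0 <= x <= 1) by lra.
      destruct (Cdiff_along_line F p v _ x (HdF _ (HR x Hx'))) as [D _].
      apply (is_derive_mult (K := R_AbsRing) phi (fun s => exp (- L * s))); auto.
      + auto_derive; auto. ring.
      + intros; apply Rmult_comm.
    - intros x Hx. specialize (Hb x ltac:(lra)).
      assert (RC := re_le_Cmod (dF (p + x * v) * v)%C). apply Rabs_le_between in RC.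
      assert (E := exp_pos (- L * x)). nra. }
  rewrite Rmult_0_r, exp_0, Rmult_1_r in Q.
  assert (E1 : exp (- L * s) * exp (L * s) = 1).
  { rewrite <- exp_plus. replace (- L * s + L * s) with 0 by ring. apply exp_0. }
  assert (E2 : exp (L * s) <= exp L).
  { destruct (Rle_lt_or_eq_dec (L * s) L) as [h|h]; [nra| |].
    - left; now apply exp_increasing.
    - rewrite h; lra. }
  assert (E3 := exp_pos (L * s)).
  replace (phi s) with (phi s * exp (- L * s) * exp (L * s)) by (rewrite Rmult_assoc, E1; ring).
  nra. }
destruct (MVT_gen (fun s : R => Im (F (p + s * v)%C)) 0 1 (fun s => Im (dF (p + s * v) * v)%C))
  as [c [Hc E]]; rewrite ?Rmin_left, ?Rmax_right in * by lra.
- intros x Hx. apply (Cdiff_along_line F p v), HdF, HR. lra.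
- intros x Hx. apply derivable_continuous_pt. eexists. apply is_derive_Reals.
  apply (Cdiff_along_line F p v), HdF, HR. lra.
- assert (E0 : (p + 0 * v)%C = p) by ring.
  assert (E1 : (p + 1 * v)%C = p') by (unfold v; ring).
  rewrite E0, E1, Rminus_0_r, Rmult_1_r in E. rewrite E.
  eapply Rle_trans; [apply im_le_Cmod|].
  specialize (Hb c Hc). specialize (G c Hc). unfold phi in G at 2. rewrite E0 in G. nra.
Qed.

Lemma sector_of_slope (K : R) (z : C) : 0 <= K -> RHP z -> Rabs (Im z) <= K * Re z ->
  sector (atan (K + 1)) z.
Proof.
destruct z as [x y]; unfold RHP; simpl. intros HK Hx Hy.
assert (Hq : Rabs (y / x) < K + 1).
{ unfold Rdiv. rewrite Rabs_mult, (Rabs_pos_eq (/ x)) by (left; now apply Rinv_0_lt_compat).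
  apply Rmult_lt_reg_r with x; auto. rewrite Rmult_assoc, Rinv_l; lra. }
exists (x / cos (atan (y / x))), (atan (y / x)).
assert (Hb := atan_bound (y / x)).
assert (Hc : 0 < cos (atan (y / x))) by (apply cos_gt_0; lra).
split; [|split].
- now apply Rdiv_lt_0_compat.
- apply Rabs_def2 in Hq. apply Rabs_def1.
  + now apply atan_increasing. + rewrite <- atan_opp. apply atan_increasing. lra.
- apply injective_projections; simpl; [field; lra|].
  transitivity (x * tan (atan (y / x))).
  + rewrite tan_atan. field. lra. + unfold tan. field. lra.
Qed.

Lemma angular_derivative_eps (f : C -> C) (l K eps : R) :
  is_angular_derivative_infty f l -> 0 <= K -> 0 < eps ->
  exists M, forall z, RHP z -> Rabs (Im z) <= K * Re z -> M < Cmod z ->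
    Cmod (f z - l * z)%C <= eps * Cmod z.
Proof.
intros Hl HK He.
assert (He2 : 0 < eps / 2) by lra.
assert (Hphi : 0 < atan (K + 1) < PI / 2).
{ split. rewrite <- atan_0. apply atan_increasing; lra. apply atan_bound. }
destruct (Hl _ Hphi (fun w => Cmod (w - l)%C <= eps)) as [M HM].
{ exists (mkposreal _ He2). intros w [H1 H2].
  unfold ball in H1, H2; simpl in H1, H2.
  unfold AbsRing_ball, abs, minus, plus, opp in H1, H2; simpl in H1, H2.
  destruct w as [w1 w2]. simpl in *.
  eapply Rle_trans; [apply (Cmod_le_sum (w1 + - l) (w2 + - 0))|]. lra. }
exists M. intros z Hz Hs Hm.
specialize (HM z Hm (sector_of_slope K z HK Hz Hs)). simpl in HM.
assert (Hnz : z <> 0). { intros ->. unfold RHP in Hz. rewrite re_RtoC in Hz. lra. }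
replace (f z - l * z)%C with ((f z / z - l) * z)%C by (field; auto).
rewrite Cmod_mult. apply Rmult_le_compat_r; auto. apply Cmod_ge_0.
Qed.

(** The ratio [Re (f (z + t)) / (Re z + t)] decreases in [t], and tends to [l]
    because the ray [z + t] is eventually contained in a sector. *)
Lemma julia (f : C -> C) (l : R) (z : C) :
  holomorphic_self_map f -> is_angular_derivative_infty f l -> RHP z ->
  l * Re z <= Re (f z).
Proof.
intros Hf Hl Hz. pose proof Hz as Hx. unfold RHP in Hx.
cut (l <= Re (f z) / Re z).
{ intros H. apply Rmult_le_reg_r with (/ Re z). now apply Rinv_0_lt_compat.
  rewrite Rmult_assoc, Rinv_r; lra. }
apply le_epsilon. intros eps He.
set (x := Re z) in *. set (y := Im z).
assert (He2 : 0 < eps / 2) by lra.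
destruct (angular_derivative_eps f l 1 (eps / 2) Hl ltac:(lra) He2) as [M HM].
(* At this [t] the point [z + t] has slope at most [1] and modulus above [M]. *)
set (t := Rabs y + Rabs M).
assert (Y0 := Rabs_pos y). assert (M0 := Rabs_pos M). assert (ML := Rle_abs M).
assert (Ht : 0 <= t) by (unfold t; lra).
assert (Ez : (z + t)%C = (x + t, y) :> C).
{ unfold x, y. destruct z; apply injective_projections; simpl; ring. }
assert (Hs : Cmod (x + t, y) <= 2 * (x + t)).
{ eapply Rle_trans; [apply Cmod_le_sum|]. rewrite (Rabs_pos_eq (x + t)) by lra.
  unfold t in *. lra. }
assert (Hlow : x + t <= Cmod (x + t, y)).
{ eapply Rle_trans; [|apply re_le_Cmod]. simpl. apply Rle_abs. }
assert (B : Cmod (f (z + t) - l * (z + t))%C <= eps / 2 * Cmod (z + t)%C).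
{ apply HM; rewrite Ez; unfold RHP; simpl; [lra| |]; unfold t in *; lra. }
assert (B2 := re_le_Cmod (f (z + t) - l * (z + t))%C). apply Rabs_le_between in B2.
unfold Cminus in B2 at 2. rewrite re_plus, re_opp, re_scal_l in B2.
rewrite Ez in *. simpl (Re (x + t, y)) in B2.
assert (D := self_map_ratio_decreasing f z t Hf Hz Ht). fold x in D. rewrite Ez in D.
apply Rle_trans with (Re (f (x + t, y)) / (x + t) + eps); [|lra].
apply Rmult_le_reg_r with (x + t); [lra|].
replace ((Re (f (x + t, y)) / (x + t) + eps) * (x + t))
  with (Re (f (x + t, y)) + eps * (x + t)) by (field; lra).
nra.
Qed.

(** * Projection onto a horizontal ray *)

Definition rhoH (z w : C) : R := Cmod ((z - w) / (z + Cconj w))%C.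

(** The relation is kept free of divisions and square roots, so that pseudo-hyperbolic
    distances can be compared by polynomial inequalities. *)
Lemma rhoH_sqr (z w : C) : RHP z -> RHP w ->
  rhoH z w ^ 2 * ((Re z + Re w) ^ 2 + (Im z - Im w) ^ 2) =
  (Re z - Re w) ^ 2 + (Im z - Im w) ^ 2.
Proof.
destruct z as [x y], w as [a b]; unfold RHP, rhoH; simpl Re; simpl Im. intros Hx Ha.
assert (Hnz : ((x, y) + Cconj (a, b))%C <> 0).
{ intros H. apply (f_equal Re) in H. simpl in H. lra. }
assert (P := proj1 (Cmod_gt_0 _) Hnz).
rewrite Cmod_div by auto.
assert (E1 := Cmod2_alt ((x, y) - (a, b))%C). assert (E2 := Cmod2_alt ((x, y) + Cconj (a, b))%C).
simpl Re in E1, E2; simpl Im in E1, E2.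
replace ((x + a) ^ 2 + (y - b) ^ 2) with (Cmod ((x, y) + Cconj (a, b))%C ^ 2)
  by (rewrite E2; ring).
unfold Rdiv. rewrite Rpow_mult_distr, Rmult_assoc, <- Rpow_mult_distr, Rinv_l, E1 by lra. ring.
Qed.

Lemma rhoH_bounds (z w : C) : RHP z -> RHP w -> 0 <= rhoH z w < 1.
Proof.
intros Hz Hw. assert (E := rhoH_sqr z w Hz Hw). unfold RHP in *.
assert (P : 0 <= rhoH z w) by apply Cmod_ge_0. split; auto.
apply Rnot_le_lt; intros H.
assert (0 <= (Im z - Im w) ^ 2) by apply pow2_ge_0.
assert (Q : 0 <= (rhoH z w ^ 2 - 1) * ((Re z + Re w) ^ 2 + (Im z - Im w) ^ 2)).
{ apply Rmult_le_pos; [|assert (0 <= (Re z + Re w) ^ 2) by apply pow2_ge_0]; nra. }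
assert (0 < Re z * Re w) by now apply Rmult_lt_0_compat. nra.
Qed.

Lemma dH_lt (z w z' w' : C) : 0 <= rhoH z w -> rhoH z w < rhoH z' w' -> rhoH z' w' < 1 ->
  dH z w < dH z' w'.
Proof.
unfold dH. fold (rhoH z w) (rhoH z' w'). intros H0 H1 H2.
apply Rmult_lt_compat_l; [lra|].
apply ln_increasing. { apply Rdiv_lt_0_compat; lra. }
apply Rmult_lt_reg_r with ((1 - rhoH z w) * (1 - rhoH z' w')).
{ apply Rmult_lt_0_compat; lra. }
field_simplify; nra.
Qed.

Section Projection.
Variables w z0 : C.
Hypotheses (Hw : RHP w) (Hz0 : RHP z0).
Let s0 : R := Cmod (z0 - (0, Im w))%C.
Hypothesis Hs : Re w < s0.

(** With [X = Re z0], [s = Re w + t] and [s0] the Euclidean distance from [z0] to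
    the endpoint [i Im w] of the full geodesic, the squared pseudo-hyperbolic
    distance is [(q - 2 X) / (q + 2 X)] where [q = s0 ^ 2 / s + s]; it is minimal
    exactly at [s = s0].  The condition [Re w < s0] says that this point of the full
    geodesic belongs to the ray. *)
Lemma dH_ray_lt (t : R) : 0 <= t -> t <> s0 - Re w ->
  dH z0 (geodesic_to_infty w (s0 - Re w)) < dH z0 (geodesic_to_infty w t).
Proof.
intros Ht Hne. unfold geodesic_to_infty.
assert (Hr : forall u, 0 <= u -> RHP (w + RtoC u)%C /\ Re (w + RtoC u)%C = Re w + u /\
  Im (w + RtoC u)%C = Im w).
{ intros u Hu. unfold RHP in *. destruct w; simpl in *. repeat split; lra. }
destruct (Hr t Ht) as (A1 & A2 & A3). destruct (Hr (s0 - Re w)) as (B1 & B2 & B3); [lra|].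
assert (E1 := rhoH_sqr _ _ Hz0 A1). assert (E2 := rhoH_sqr _ _ Hz0 B1).
assert (P1 := rhoH_bounds _ _ Hz0 A1). assert (P2 := rhoH_bounds _ _ Hz0 B1).
apply dH_lt; try lra.
rewrite A2, A3 in E1. rewrite B2, B3 in E2.
set (r := rhoH z0 (w + RtoC (s0 - Re w))%C) in *.
set (r' := rhoH z0 (w + RtoC t)%C) in *. clearbody r r'.
assert (EN : s0 ^ 2 = Re z0 ^ 2 + (Im z0 - Im w) ^ 2).
{ unfold s0. rewrite Cmod2_alt. destruct z0, w; simpl; ring. }
unfold RHP in *.
set (X := Re z0) in *. set (Y := Im z0 - Im w) in *.
replace (Re w + (s0 - Re w)) with s0 in E2 by ring.
set (s := Re w + t) in *. assert (Hs0 : s <> s0) by (unfold s; lra).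
assert (Sp : 0 < s) by (unfold s; lra). assert (S0p : 0 < s0) by lra.
clearbody X Y s0 s.
apply Rnot_le_lt; intros Hle.
assert (Q : r' ^ 2 <= r ^ 2) by (apply pow_incr; lra).
assert (D1 : 0 < (X + s) ^ 2 + Y ^ 2). { assert (0 <= Y ^ 2) by apply pow2_ge_0. nra. }
assert (D2 : 0 < (X + s0) ^ 2 + Y ^ 2). { assert (0 <= Y ^ 2) by apply pow2_ge_0. nra. }
assert (K : ((X - s) ^ 2 + Y ^ 2) * ((X + s0) ^ 2 + Y ^ 2) <=
            ((X - s0) ^ 2 + Y ^ 2) * ((X + s) ^ 2 + Y ^ 2)).
{ rewrite <- E1, <- E2.
  replace (r ^ 2 * ((X + s0) ^ 2 + Y ^ 2) * ((X + s) ^ 2 + Y ^ 2))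
    with (r ^ 2 * (((X + s) ^ 2 + Y ^ 2) * ((X + s0) ^ 2 + Y ^ 2))) by ring.
  rewrite Rmult_assoc. apply Rmult_le_compat_r; auto. apply Rmult_le_pos; lra. }
assert (G : ((X - s) ^ 2 + Y ^ 2) * ((X + s0) ^ 2 + Y ^ 2) -
            ((X - s0) ^ 2 + Y ^ 2) * ((X + s) ^ 2 + Y ^ 2) =
            4 * X * s0 * (s - s0) ^ 2).
{ replace (Y ^ 2) with (s0 ^ 2 - X ^ 2) by lra. ring. }
assert (0 < (s - s0) ^ 2).
{ assert (0 <= (s - s0) ^ 2) by apply pow2_ge_0.
  assert ((s - s0) ^ 2 <> 0) by (apply pow_nonzero; lra). lra. }
assert (0 < 4 * X * s0) by nra. nra.
Qed.

Lemma projection_ray :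
  projection (geodesic_to_infty w) z0 = geodesic_to_infty w (s0 - Re w).
Proof.
set (ga := geodesic_to_infty w).
assert (G : Glb_Rbar (fun d : R => exists t : R, 0 <= t /\ d = dH z0 (ga t)) =
   Finite (dH z0 (ga (s0 - Re w)))).
{ apply is_glb_Rbar_unique. split.
  - intros d (t & Ht & ->). simpl. destruct (Req_dec t (s0 - Re w)) as [->|Hn]; [lra|].
    left. now apply dH_ray_lt.
  - intros b Hb. apply Hb. exists (s0 - Re w). split; auto. lra. }
assert (E : is_projection ga z0 (projection ga z0)).
{ unfold projection. apply epsilon_spec. exists (ga (s0 - Re w)), (s0 - Re w).
  repeat split. lra. now symmetry. }
destruct E as (t & Ht & E & D). rewrite E. f_equal.
destruct (Req_dec t (s0 - Re w)) as [|Hn]; auto. exfalso.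
rewrite G in D. injection D as D. assert (L := dH_ray_lt t Ht Hn). fold ga in L. lra.
Qed.
End Projection.

Lemma dH_along_ray (w : C) (t t' : R) : RHP w -> 0 <= t -> t < t' ->
  dH w (geodesic_to_infty w t) < dH w (geodesic_to_infty w t').
Proof.
intros Hw Ht Htt. unfold RHP in Hw.
assert (E : forall u, 0 <= u -> rhoH w (geodesic_to_infty w u) = u / (2 * Re w + u)).
{ intros u Hu. unfold rhoH, geodesic_to_infty.
  replace ((w - (w + u)) / (w + Cconj (w + u)))%C with (RtoC (- u / (2 * Re w + u))).
  - rewrite Cmod_R. unfold Rdiv. rewrite Rabs_mult, Rabs_Ropp, !Rabs_pos_eq; auto.
    left; apply Rinv_0_lt_compat; lra.
  - rewrite RtoC_div by lra. f_equal; destruct w; apply injective_projections; simpl; ring. }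
assert (D : t' / (2 * Re w + t') - t / (2 * Re w + t) =
  2 * Re w * (t' - t) / ((2 * Re w + t) * (2 * Re w + t'))) by (field; lra).
assert (0 < 2 * Re w * (t' - t) / ((2 * Re w + t) * (2 * Re w + t'))).
{ apply Rdiv_lt_0_compat; apply Rmult_lt_0_compat; lra. }
apply dH_lt; rewrite !E by lra.
- apply Rmult_le_pos; auto. left; apply Rinv_0_lt_compat; lra.
- lra.
- assert (D1 : 1 - t' / (2 * Re w + t') = 2 * Re w / (2 * Re w + t')) by (field; lra).
  assert (0 < 2 * Re w / (2 * Re w + t')) by (apply Rdiv_lt_0_compat; lra). lra.
Qed.

Lemma eventually_strictly_increasing_of_step (u : nat -> R) (N : nat) :
  (forall n, (N <= n)%nat -> u n < u (S n)) -> eventually_strictly_increasing u.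
Proof.
intros H. exists N. intros n m Hn Hm. induction Hm as [|m Hm IH]; auto.
apply Rlt_trans with (1 := IH), H. lia.
Qed.

(** * Orbits of hyperbolic maps *)

Section Orbit.
Variables (f : C -> C) (l : R) (z : C).
Hypotheses (Hf : holomorphic_self_map f) (Hl : is_angular_derivative_infty f l)
  (l1 : 1 < l) (Hz : RHP z).

Let Z (n : nat) : C := iterate f n z.

Lemma orbit_RHP (n : nat) : RHP (Z n).
Proof. now apply (iterate_self_map f n Hf). Qed.

Lemma orbit_re_growth (n : nat) : l * Re (Z n) <= Re (Z (S n)).
Proof. apply (julia f l (Z n)); auto. apply orbit_RHP. Qed.

Lemma orbit_re_infty (M : R) : exists N, forall n, (N <= n)%nat -> M < Re (Z n).
Proof.
assert (G : forall n, l ^ n * Re z <= Re (Z n)).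
{ induction n as [|n IH]. { unfold Z; simpl; lra. }
  assert (S := orbit_re_growth n). simpl. rewrite Rmult_assoc.
  eapply Rle_trans; [|exact S]. apply Rmult_le_compat_l; lra. }
unfold RHP in Hz.
destruct (Pow_x_infinity l) with (b := Rabs M / Re z + 1) as [N HN].
{ rewrite Rabs_pos_eq; lra. }
exists N. intros n Hn. specialize (HN n Hn). specialize (G n).
rewrite Rabs_pos_eq in HN by (apply pow_le; lra).
assert (ML := Rle_abs M).
assert (Rabs M + Re z <= l ^ n * Re z).
{ replace (Rabs M + Re z) with ((Rabs M / Re z + 1) * Re z) by (field; lra).
  apply Rmult_le_compat_r; lra. }
lra.
Qed.

(** The orbit stays in a sector.  The imaginary part moves by at most [K * Re (Z n)]
    at the [n]-th step while the real part is multiplied by at least [l > 1], so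
    the steps of the imaginary part are dominated by a geometric series. *)
Lemma orbit_slope : exists K, 0 <= K /\ forall n, Rabs (Im (Z n)) <= K * Re (Z n).
Proof.
destruct (im_variation_bound z (f z) Hz) as [K [HK Hstep]]. { now apply Hf. }
assert (Hx := Hz). unfold RHP in Hx.
assert (Y0 := Rabs_pos (Im z)).
(* The slope [S] satisfies [S + K <= S * l], which makes [|Im| <= S * Re]
   invariant along the orbit. *)
set (S := Rabs (Im z) / Re z + K / (l - 1)).
assert (S1 : 0 <= Rabs (Im z) / Re z).
{ apply Rmult_le_pos; auto. left; now apply Rinv_0_lt_compat. }
assert (S2 : 0 <= K / (l - 1)).
{ apply Rmult_le_pos; auto. left; apply Rinv_0_lt_compat; lra. }
assert (HS : 0 <= S) by (unfold S; lra).
assert (HKS : K <= S * (l - 1)).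
{ apply Rle_trans with (K / (l - 1) * (l - 1)). right; field; lra.
  apply Rmult_le_compat_r; unfold S; lra. }
exists S. split; auto. induction n as [|n IH].
- unfold Z; simpl. apply Rle_trans with (Rabs (Im z) / Re z * Re z). right; field; lra.
  apply Rmult_le_compat_r; unfold S; lra.
- assert (E : Z (Datatypes.S n) = iterate f n (f z)) by (apply Nat.iter_succ_r).
  specialize (Hstep _ (iterate_self_map f n Hf)). rewrite <- E in Hstep. fold (Z n) in Hstep.
  assert (G := orbit_re_growth n).
  assert (P := orbit_RHP n). unfold RHP in P.
  replace (Im (Z (Datatypes.S n))) with (Im (Z (Datatypes.S n)) - Im (Z n) + Im (Z n)) by ring.
  eapply Rle_trans; [apply Rabs_triang|]. nra.
Qed.

(** In a sector [f] is asymptotic to multiplication by [l > 1], so the moduli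
    of the orbit grow at least by the factor [(1 + l) / 2] eventually; as they tend
    to infinity, moving the centre from [0] to [i b] does not affect monotonicity. *)
Lemma orbit_dist_increasing (b : R) : exists N, forall n, (N <= n)%nat ->
  Cmod (Z n - (0, b))%C < Cmod (Z (S n) - (0, b))%C.
Proof.
destruct orbit_slope as [K [HK Hs]].
set (eps := (l - 1) / 2). assert (He : 0 < eps) by (unfold eps; lra).
destruct (angular_derivative_eps f l K eps Hl HK He) as [M HM].
destruct (orbit_re_infty (Rmax M (2 * Rabs b / eps))) as [N HN].
exists N. intros n Hn. specialize (HN n Hn).
assert (M1 := Rmax_l M (2 * Rabs b / eps)). assert (M2 := Rmax_r M (2 * Rabs b / eps)).
assert (RC := re_le_Cmod (Z n)). assert (RA := Rle_abs (Re (Z n))).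
specialize (HM (Z n) (orbit_RHP n) (Hs n) ltac:(lra)).
change (f (Z n)) with (Z (S n)) in HM.
assert (Hb : Cmod (0, b) = Rabs b).
{ apply Rle_antisym; [|apply (im_le_Cmod (0, b))].
  eapply Rle_trans; [apply Cmod_le_sum|]. rewrite Rabs_R0; lra. }
assert (B : 2 * Rabs b < eps * Cmod (Z n)).
{ replace (2 * Rabs b) with (eps * (2 * Rabs b / eps)) by (field; lra).
  apply Rmult_lt_compat_l; lra. }
assert (T1 : Cmod (Z n - (0, b))%C <= Cmod (Z n) + Rabs b).
{ unfold Cminus. rewrite <- Hb, <- (Cmod_opp (0, b)). apply Cmod_triangle. }
assert (T2 : Cmod (Z (S n)) <= Cmod (Z (S n) - (0, b))%C + Rabs b).
{ rewrite <- Hb. replace (Z (S n)) with (Z (S n) - (0, b) + (0, b))%C at 1 by ring.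
  apply Cmod_triangle. }
assert (T3 : l * Cmod (Z n) <= Cmod (Z (S n)) + Cmod (Z (S n) - l * Z n)%C).
{ assert (El : Cmod (l * Z n)%C = l * Cmod (Z n)).
  { rewrite Cmod_mult, Cmod_R, Rabs_pos_eq; lra. }
  assert (Ed : (l * Z n)%C = (Z (S n) + - (Z (S n) - l * Z n))%C) by ring.
  rewrite <- El, <- (Cmod_opp (Z (S n) - l * Z n)%C).
  eapply Rle_trans; [right; exact (f_equal Cmod Ed)|apply Cmod_triangle]. }
unfold eps in *. lra.
Qed.
End Orbit.

Theorem corollary5p2 (f : C -> C)
    (hf : holomorphic_self_map f) (hhyp : hyperbolic_infty f)
    (w : C) (hw : RHP w) (z : C) (hz : RHP z) :
  eventually_strictly_increasing
    (fun n : nat =>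
       dH w (projection (geodesic_to_infty w) (iterate f n z))).
Proof.
destruct hhyp as [_ [l [Hl l1]]].
destruct (orbit_dist_increasing f l z hf Hl l1 hz (Im w)) as [N1 H1].
destruct (orbit_re_infty f l z hf Hl l1 hz (Re w)) as [N2 H2].
assert (H3 : forall n, (N2 <= n)%nat -> Re w < Cmod (iterate f n z - (0, Im w))%C).
{ intros n Hn. eapply Rlt_le_trans; [apply (H2 n Hn)|].
  eapply Rle_trans; [|apply re_le_Cmod]. unfold Cminus. rewrite re_plus, re_opp.
  simpl (Re (0, Im w)). rewrite Ropp_0, Rplus_0_r. apply Rle_abs. }
apply (eventually_strictly_increasing_of_step _ (N1 + N2)). intros n Hn.
assert (Hn3 := H3 n ltac:(lia)). assert (Hn3' := H3 (S n) ltac:(lia)).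
specialize (H1 n ltac:(lia)).
rewrite !projection_ray; auto; try (now apply iterate_self_map).
apply dH_along_ray; auto; lra.
Qed.
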